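(* Let $F$ be an algebraically closed field and let $s\ge 1$ be an integer. Let $n\ge 2$ and $m\ge 1$ be integers, and let $\varepsilon=\sqrt[n]{s}-\lfloor\sqrt[n]{s}\rfloor$ (so $0\le\varepsilon<1$) be the fractional part of $\sqrt[n]{s}$. If $$\lfloor\sqrt[n]{s}\rfloor-2\ge \frac{2\varepsilon}{n-1}(m-1),$$ then for the homogeneous ideal $I\subseteq F[x_0,\ldots,x_n]$ of $s$ very general points in $\mathbb{P}^n$ over $F$, $$\widehat{\alpha}(I)\ge\frac{\alpha(I^{(m)})+n-1}{m+n-1}.$$ In particular, if $n\ge 1$ is an integer such that $\sqrt[n]{s}$ is an integer, then for the homogeneous ideal $I$ of $s$ very general points in $\mathbb{P}^n$ over $F$, the inequality $$\widehat{\alpha}(I)\ge\frac{\alpha(I^{(m)})+n-1}{m+n-1}$$ holds for all integers $m\ge 1$.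
   Context: For a nonzero homogeneous ideal $J\subseteq F[x_0,\ldots,x_n]$, $\alpha(J)=\min\{\deg f\mid f \text{ is a nonzero homogeneous polynomial in } J\}$. If $I$ is the homogeneous ideal of the finite set of points $\{p_1,\ldots,p_s\}\subset\mathbb{P}^n$, then for an integer $m\ge 1$ the $m$-th symbolic power $I^{(m)}$ is the ideal generated by all homogeneous polynomials $f\in F[x_0,\ldots,x_n]$ that vanish to order at least $m$ at each $p_i$. The Waldschmidt constant of $I$ is $\widehat{\alpha}(I)=\inf_{m\ge 1}\frac{\alpha(I^{(m)})}{m}$, which equals $\lim_{m\to\infty}\frac{\alpha(I^{(m)})}{m}$. A statement holds for $s$ very general points in $\mathbb{P}^n$ if there are countably many proper Zariski closed subsets of $(\mathbb{P}^n)^s$ such that the statement holds for every set $\{p_1,\ldots,p_s\}$ of $s$ distinct points for which $(p_1,\ldots,p_s)$ lies outside the union of these closed subsets. *)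

(* Defs.v *)
From HB Require Import structures.
From mathcomp Require Export all_boot all_order all_algebra.
From mathcomp Require Export mpoly.
From mathcomp Require Export boolp classical_sets reals.
From mathcomp Require Export exp.

Set Implicit Arguments.
Unset Strict Implicit.
Unset Printing Implicit Defensive.

Export Order.TTheory GRing.Theory Num.Theory.

Local Open Scope classical_set_scope.
Local Open Scope ring_scope.

(* An s-tuple of points of P^n is given by homogeneous coordinates: a matrix   *)
(* p : 'M[F]_(s, n.+1) whose rows are nonzero, row i p representing the i-th   *)
(* point. All the notions below are invariant under rescaling the rows.        *)

Section Ideals.
Variables (F : fieldType) (k : nat).

Definition ideal_gen (S : set {mpoly F[k]}) : set {mpoly F[k]} :=
  [set f | exists (l : nat) (c g : 'I_l -> {mpoly F[k]}),
     (forall i, S (g i)) /\ f = \sum_(i < l) c i * g i].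

Definition has_form_of_deg (J : set {mpoly F[k]}) (d : nat) : Prop :=
  exists f : {mpoly F[k]}, [/\ J f, f != 0 & f \is d.-homog].

(* The value 0 is a dummy, taken when J has no nonzero homogeneous element.    *)
Definition alpha (J : set {mpoly F[k]}) : nat :=
  if pselect (exists d, `[< has_form_of_deg J d >]) is left exJ
  then ex_minn exJ else 0%N.

(* Order of vanishing >= m at v, in every characteristic: the Taylor expansion *)
(* f(v + X) has no monomial of degree < m. For a homogeneous f and v != 0 this *)
(* is the order of vanishing of f at the point [v] of projective space.        *)
Definition vanishes_to_order (f : {mpoly F[k]}) (v : 'rV[F]_k) (m : nat) :
    Prop :=
  forall mon : 'X_{1..k},
    mon \in msupp (f \mPo [tuple (v ord0 i)%:MP + 'X_i | i < k]) ->
    (m <= mdeg mon)%N.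

End Ideals.

Section Points.
Variables (F : fieldType) (s n : nat).

(* I^(m), for I the homogeneous ideal of the points given by the rows of p.    *)
Definition symbolic_power (p : 'M[F]_(s, n.+1)) (m : nat) :
    set {mpoly F[n.+1]} :=
  ideal_gen [set f | (exists d : nat, f \is d.-homog) /\
                     forall i : 'I_s, vanishes_to_order f (row i p) m].

Definition waldschmidt (R : realType) (p : 'M[F]_(s, n.+1)) : R :=
  inf [set x : R | exists2 m : nat, (1 <= m)%N &
                     x = (alpha (symbolic_power p m))%:R / m%:R].

Definition points_tuple (p : 'M[F]_(s, n.+1)) : Prop :=
  forall i : 'I_s, row i p != 0.

Definition distinct_points (p : 'M[F]_(s, n.+1)) : Prop :=
  forall i j : 'I_s, i != j -> ~ exists c : F, row i p = c *: row j p.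

(* Polynomials in the s * n.+1 coordinates of s points that are homogeneous in *)
(* the coordinates of each point separately; mxvec_index i j is the variable   *)
(* for the j-th coordinate of the i-th point.                                  *)
Definition multihomogeneous (f : {mpoly F[s * n.+1]}) : Prop :=
  exists d : 'I_s -> nat, forall mon : 'X_{1..s * n.+1}, mon \in msupp f ->
    forall i : 'I_s, (\sum_(j < n.+1) mon (mxvec_index i j))%N = d i.

Definition zero_locus (S : set {mpoly F[s * n.+1]}) : set 'M[F]_(s, n.+1) :=
  [set p | points_tuple p /\
           forall f, S f -> f.@[fun k => mxvec p ord0 k] = 0].

Definition zariski_closed (Z : set 'M[F]_(s, n.+1)) : Prop :=
  exists S : set {mpoly F[s * n.+1]},
    (forall f, S f -> multihomogeneous f) /\ Z = zero_locus S.

Definition proper_zariski_closed (Z : set 'M[F]_(s, n.+1)) : Prop :=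
  zariski_closed Z /\ exists2 p, points_tuple p & ~ Z p.

(* Repetitions and the empty set are allowed among the Z k, so this covers     *)
(* finite families as well.                                                    *)
Definition very_general (P : 'M[F]_(s, n.+1) -> Prop) : Prop :=
  exists Z : nat -> set 'M[F]_(s, n.+1),
    (forall k, proper_zariski_closed (Z k)) /\
    forall p, points_tuple p -> distinct_points p ->
      (forall k, ~ Z k p) -> P p.

End Points.

Definition nth_root (R : realType) (n s : nat) : R := s%:R `^ n%:R^-1.

(* Main.v *)
Require Import Defs.
From mathcomp Require Import perm zify ring lra.

Set Implicit Arguments.
Unset Strict Implicit.
Unset Printing Implicit Defensive.

Local Open Scope ring_scope.

(* Let r be the n-th root of s and k its integral part. A form of degree less  *)
(* than k m cannot vanish to order m on a grid of k^n <= s points, because     *)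
(* restricting it to the k hyperplanes of one direction and dividing them out  *)
(* lowers (n, m). Vanishing to order m at s points being a linear condition    *)
(* with multihomogeneous coefficients, for each (d, m) with d < k m a nonzero  *)
(* maximal minor at the grid cuts out a proper closed set outside of which no  *)
(* such form exists; so the Waldschmidt constant is at least k very generally. *)
(* Conversely, comparing binom(d + n, n) with s binom(m + n - 1, n) for        *)
(* d = k (m + n - 1) - (n - 1) shows that I^(m) has a form of degree d, hence  *)
(* (alpha(I^(m)) + n - 1) / (m + n - 1) <= k.                                  *)

(** * Polynomials vanishing on a grid *)

(** The integer k separates the two sides. That the Waldschmidt constant is at least k is
    [very_general_waldschmidt_ge]: [grid_form_eq0] excludes unexpected forms at the grid tuple of
    [exists_no_form_tuple], and [no_form_generic] carries this over to the complement of a proper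
    closed set, one for each of the countably many pairs (d, m). That (alpha(I^(m)) + n - 1) / (m +
    n - 1) is at most k holds for every tuple of points as soon as a numerical inequality does; this
    is the content of [demailly_bound], by the dimension count of [exists_form] and the estimate
    [binomial_lt]. With r = k + eps that inequality reads 2 eps (m - 1) + eps (n + 1) < (k - 2)(n -
    1) + (n + 1), which follows from the hypothesis and eps < 1. For eps = 0 it becomes 0 < (k -
    1)(n - 1) + 2, true for all m at once. *)

Section Tower.
Variable F : fieldType.

(** Iterated univariate polynomials, the last variable outermost: restricting to a hyperplane on
    which that variable is constant is a Horner evaluation, and the factor theorem applies. *)
Fixpoint tower (n : nat) : comNzRingType :=
  if n is n'.+1 then {poly (tower n')} else F.

Fixpoint tconst (n : nat) : {rmorphism F -> tower n} :=
  if n is n'.+1 return {rmorphism F -> tower n}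
  then (polyC \o tconst n' : {rmorphism F -> {poly tower n'}})
  else (idfun : {rmorphism F -> F}).

Fixpoint tvar (n j : nat) : tower n :=
  if n is n'.+1 return tower n
  then if j == n' then ('X : {poly tower n'}) else (tvar n' j)%:P
  else 0.

Fixpoint tcoef (n : nat) (e : nat -> nat) : tower n -> F :=
  if n is n'.+1 return tower n -> F
  then fun f : {poly tower n'} => tcoef e f`_(e n')
  else fun c => c.

(* Total degree less than d; truncated subtraction forces f`_i = 0 for i >= d. *)
Fixpoint tdeg_lt (n d : nat) : tower n -> Prop :=
  if n is n'.+1 return tower n -> Prop
  then fun f : {poly tower n'} => forall i, tdeg_lt (d - i) f`_i
  else fun c => d = 0%N -> c = 0.

(* Vanishing to order at least m at (a 0, ..., a (n - 1)). *)
Fixpoint tord_ge (a : nat -> F) (n m : nat) : tower n -> Prop :=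
  if n is n'.+1 return tower n -> Prop
  then fun f : {poly tower n'} =>
    forall i, tord_ge a (m - i) (f \Po ('X + (tconst n' (a n'))%:P))`_i
  else fun c => (0 < m)%N -> c = 0.

Lemma tdeg_ltD n d (f g : tower n) :
  tdeg_lt d f -> tdeg_lt d g -> tdeg_lt d (f + g).
Proof.
elim: n d f g => [|n IH] d f g /= hf hg; first by move=> d0; rewrite hf // hg // addr0.
by move=> i; rewrite coefD; apply: IH.
Qed.

Lemma tdeg_lt0 n d : tdeg_lt d (0 : tower n).
Proof. by elim: n d => [|n IH] d //= i; rewrite coef0. Qed.

Lemma tdeg_lt_eq0 n (f : tower n) : tdeg_lt 0 f -> f = 0.
Proof.
elim: n f => [|n IH] f /= hf; first exact: hf.
by apply/polyP => i; rewrite coef0; apply: IH; rewrite -(sub0n i).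
Qed.

Lemma tdeg_ltW n d e (f : tower n) : (d <= e)%N -> tdeg_lt d f -> tdeg_lt e f.
Proof.
elim: n d e f => [|n IH] d e f /= de hf.
  by move=> e0; apply: hf; apply/eqP; rewrite -leqn0 -e0.
by move=> i; apply: IH (hf i); rewrite leq_sub2r.
Qed.

Lemma tdeg_lt_constM n d c (f : tower n) :
  tdeg_lt d f -> tdeg_lt d (tconst n c * f).
Proof.
elim: n d f => [|n IH] d f /= hf; first by move=> d0; rewrite hf // mulr0.
by move=> i; rewrite coefCM; apply: IH.
Qed.

Lemma tdeg_lt_sum n d I (r : seq I) (P : pred I) (f : I -> tower n) :
  (forall i, P i -> tdeg_lt d (f i)) -> tdeg_lt d (\sum_(i <- r | P i) f i).
Proof.
move=> h; elim/big_rec: _ => [|i x Pi hx]; first exact: tdeg_lt0.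
exact/tdeg_ltD/hx/h.
Qed.

Section Order.
Variable a : nat -> F.

Lemma tord_geD n m (f g : tower n) :
  tord_ge a m f -> tord_ge a m g -> tord_ge a m (f + g).
Proof.
elim: n m f g => [|n IH] m f g /= hf hg; first by move=> d0; rewrite hf // hg // addr0.
by move=> i; rewrite comp_polyD coefD; apply: IH.
Qed.

Lemma tord_ge0 n m : tord_ge a m (0 : tower n).
Proof. by elim: n m => [|n IH] m //= i; rewrite comp_poly0 coef0. Qed.

Lemma tord_geW n m k (f : tower n) : (k <= m)%N -> tord_ge a m f -> tord_ge a k f.
Proof.
elim: n m k f => [|n IH] m k f /= km hf; first by move=> k0; apply/hf/(leq_trans k0).
by move=> i; apply: IH (hf i); rewrite leq_sub2r.
Qed.

Lemma tord_ge_constM n m c (f : tower n) :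
  tord_ge a m f -> tord_ge a m (tconst n c * f).
Proof.
elim: n m f => [|n IH] m f /= hf; first by move=> d0; rewrite hf // mulr0.
by move=> i; rewrite comp_polyM comp_polyC coefCM; apply: IH.
Qed.

Lemma tord_geB n m (f g : tower n) :
  tord_ge a m f -> tord_ge a m g -> tord_ge a m (f - g).
Proof.
move=> hf hg; apply: tord_geD => //.
by rewrite -mulN1r -(rmorph1 (tconst n)) -rmorphN; apply: tord_ge_constM.
Qed.

Lemma tord_ge_sum n m I (r : seq I) (P : pred I) (f : I -> tower n) :
  (forall i, P i -> tord_ge a m (f i)) -> tord_ge a m (\sum_(i <- r | P i) f i).
Proof.
move=> h; elim/big_rec: _ => [|i x Pi hx]; first exact: tord_ge0.
exact/tord_geD/hx/h.
Qed.

End Order.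

Lemma eq_tord_ge n m a b (f : tower n) :
  (forall j, (j < n)%N -> a j = b j) -> tord_ge a m f -> tord_ge b m f.
Proof.
elim: n m f => [|n IH] m f //= eqab hf i.
rewrite -eqab //; apply: IH (hf i) => j jn; apply: eqab; exact: ltnW.
Qed.

Lemma tdeg_lt_horner n d b (f : tower n.+1) :
  tdeg_lt d f -> tdeg_lt d (f : {poly tower n}).[tconst n b].
Proof.
move=> hf; rewrite horner_coef; apply: tdeg_lt_sum => i _.
rewrite -rmorphXn mulrC; apply: tdeg_lt_constM; apply: tdeg_ltW (hf i).
exact: leq_subr.
Qed.

Lemma coef0_comp_XaddC (S : comNzRingType) (f : {poly S}) c :
  (f \Po ('X + c%:P))`_0 = f.[c].
Proof. by rewrite -horner_coef0 horner_comp !hornerE. Qed.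

Lemma tord_ge_horner n m a (f : tower n.+1) :
  tord_ge a m f -> tord_ge a m (f : {poly tower n}).[tconst n (a n)].
Proof. by move=> /(_ 0%N); rewrite coef0_comp_XaddC subn0. Qed.

(** If f is the product, then h_i = f_(i+1) + b h_(i+1), so the bounds propagate downwards from the
    top coefficient. *)
Lemma tdeg_lt_divX n d b (h : {poly tower n}) :
  @tdeg_lt n.+1 d (('X - (tconst n b)%:P) * h) -> @tdeg_lt n.+1 d.-1 h.
Proof.
move=> hf i.
have [k] := ubnP (size h - i); elim: k i => // k IH i lek.
have [hi|hi] := leqP (size h) i; first by rewrite nth_default //; apply: tdeg_lt0.
have := hf i.+1; rewrite mulrBl coefB coefXM /= coefCM => hfi.
rewrite -[h`_i](subrK (tconst n b * h`_i.+1)).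
apply: tdeg_ltD; first by apply: tdeg_ltW hfi; lia.
apply: tdeg_lt_constM; apply: tdeg_ltW (IH i.+1 _); lia.
Qed.

Lemma comp_XsubC_XaddC (S : comNzRingType) (h : {poly S}) b c :
  (('X - b%:P) * h) \Po ('X + c%:P) =
  'X * (h \Po ('X + c%:P)) + (c - b)%:P * (h \Po ('X + c%:P)).
Proof.
by rewrite comp_polyM comp_polyB comp_polyX comp_polyC polyCB -mulrDl addrA.
Qed.

(** At a point of the hyperplane the linear factor becomes X after translation, and dividing by X
    only shifts coefficients. *)
Lemma tord_ge_divX n m a (h : {poly tower n}) :
  @tord_ge a n.+1 m (('X - (tconst n (a n))%:P) * h) -> @tord_ge a n.+1 m.-1 h.
Proof.
move=> hf i; have := hf i.+1.
rewrite comp_XsubC_XaddC subrr mul0r addr0 coefXM /=.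
by apply: tord_geW; lia.
Qed.

(** Off the hyperplane the translated factor is X plus the nonzero constant [a n - b]; the
    coefficients of the quotient are recovered one by one from the lowest. *)
Lemma tord_ge_divX_neq n m a b (h : {poly tower n}) : a n != b ->
  @tord_ge a n.+1 m (('X - (tconst n b)%:P) * h) -> @tord_ge a n.+1 m h.
Proof.
move=> ab hf; pose g := h \Po ('X + (tconst n (a n))%:P).
suff H i : tord_ge a (m - i) g`_i by [].
have unscale x k : tord_ge a k (tconst n (a n - b) * x) -> tord_ge a k x.
  move=> /(tord_ge_constM (a n - b)^-1).
  by rewrite mulrA -rmorphM mulVf ?subr_eq0 // rmorph1 mul1r.
elim: i => [|i IH]; apply: unscale.
  have := hf 0%N; rewrite comp_XsubC_XaddC coefD coefXM coefCM /= add0r.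
  by rewrite -rmorphB.
have := hf i.+1; rewrite comp_XsubC_XaddC coefD coefXM coefCM /= -rmorphB.
rewrite -/g => hfi; rewrite -[_ * _](addKr g`_i) addrC.
by apply: tord_geB => //; apply: tord_geW IH; lia.
Qed.

(* Restricting f to a hyperplane x_n = b with b in A gives 0 by induction on   *)
(* n, so f is divisible by the product of the x_n - b; dividing it out lowers  *)
(* the degree by size A and each order of vanishing by at most one.            *)
Lemma grid_eq0 (A : seq F) n m (f : tower n) : uniq A ->
  tdeg_lt (size A * m) f ->
  (forall a, (forall j, a j \in A) -> tord_ge a m f) -> f = 0.
Proof.
move=> uA; elim: n m f => [|n IHn] m f.
  case: m => [|m]; first by rewrite muln0 => /tdeg_lt_eq0.
  case: A {uA} => [|c A]; first by rewrite mul0n => /tdeg_lt_eq0.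
  by move=> _ /(_ (fun=> c)); apply => // j; rewrite inE eqxx.
elim: m f => [|m IHm] f; first by rewrite muln0 => /tdeg_lt_eq0.
move=> df vf.
(* The hyperplanes are divided out one at a time; a point has lost one order only if its own
   hyperplane is already among those of [B]. *)
suff H (B : seq F) : uniq B -> {subset B <= A} ->
    exists h : tower n.+1, [/\ (f : {poly tower n}) =
        (\prod_(b <- B) ('X - (tconst n b)%:P)) * (h : {poly tower n}),
      tdeg_lt (size A * m.+1 - size B) h &
      forall a, (forall j, a j \in A) -> tord_ge a (m.+1 - (a n \in B)) h].
  have [h [-> dh vh]] := H A uA (fun _ => id).
  rewrite (IHm h) ?mulr0 //.
    by move: dh; rewrite mulnS addKn.
  by move=> a aA; have := vh a aA; rewrite aA subn1.
elim: B => [|b B IHB] /=.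
  move=> _ _; exists f; split; [by rewrite big_nil mul1r|by rewrite subn0|].
  by move=> a aA; apply: vf.
move=> /andP[bB uB] sB.
have [||h [fE dh vh]] := IHB; [by []|by move=> x xB; apply: sB; rewrite inE xB orbT|].
have bA : b \in A by apply: sB; rewrite inE eqxx.
have : (h : {poly tower n}).[tconst n b] = 0.
  apply: (IHn m.+1).
    by apply: tdeg_lt_horner; apply: tdeg_ltW dh; apply: leq_subr.
  (* Lift the point to the hyperplane of [b]: as [b] is not in [B], the quotient [h] still has full
     order [m.+1] there. *)
  move=> a aA; pose a' j := if j == n then b else a j.
  have a'n : a' n = b by rewrite /a' eqxx.
  have := vh a'; rewrite a'n (negPf bB) subn0 => /(_ _)/tord_ge_horner.
  rewrite a'n => ha.
  apply: (@eq_tord_ge n m.+1 a'); last by apply: ha => j; rewrite /a'; case: ifP.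
  by move=> j jn; rewrite /a' ltn_eqF.
move=> /eqP/factor_theorem[q hE]; rewrite mulrC in hE.
exists q; split.
- by rewrite big_cons -mulrA mulrCA -hE fE.
- by rewrite subnS; apply: (@tdeg_lt_divX n _ b); rewrite -hE.
- move=> a aA; have := vh a aA; rewrite hE inE; have [ab|ab] := eqVneq (a n) b.
    by rewrite -{1 2}ab in bB *; rewrite (negPf bB) subn0 /= subn1; exact: tord_ge_divX.
  by move=> ?; exact: (tord_ge_divX_neq ab).
Qed.

End Tower.

(** * Taylor coefficients of forms *)

Section Taylor.
Variable k : nat.

(* The coefficient of Y^mon in (v + Y)^u. *)
Definition taylor_mon (S : comNzRingType) (v : 'I_k -> S) (mon u : 'X_{1..k}) : S :=
  \prod_(j < k) (v j ^+ (u j - mon j) *+ 'C(u j, mon j)).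

Definition taylor_coef (F : fieldType) (f : {mpoly F[k]}) (v : 'I_k -> F)
    (mon : 'X_{1..k}) : F :=
  \sum_(u <- msupp f) f@_u * taylor_mon v mon u.

Definition mnm_of_ffun N (e : {ffun 'I_k -> 'I_N}) : 'X_{1..k} :=
  [multinom (e j : nat) | j < k].

Lemma prod_exprD (S : comNzRingType) (x y : 'I_k -> S) (u : 'X_{1..k}) N :
  (mdeg u <= N)%N ->
  \prod_(j < k) (x j + y j) ^+ u j =
  \sum_(e : {ffun 'I_k -> 'I_N.+1})
    taylor_mon x (mnm_of_ffun e) u * \prod_(j < k) y j ^+ e j.
Proof.
move=> uN; have leuN j : (u j < N.+1)%N.
  by rewrite ltnS (leq_trans _ uN) // mdegE (bigD1 j) //= leq_addr.
transitivity (\prod_(j < k) \sum_(i < N.+1)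
    (x j ^+ (u j - i) *+ 'C(u j, i)) * y j ^+ i).
  apply: eq_bigr => j _; rewrite exprDn.
  rewrite (big_ord_widen _ (fun i => x j ^+ (u j - i) * y j ^+ i *+ 'C(u j, i)) (leuN j)).
  rewrite big_mkcond; apply: eq_bigr => i _; rewrite ltnS mulrnAl.
  by case: leqP => // ui; rewrite bin_small // mulr0n.
rewrite bigA_distr_bigA; apply: eq_bigr => e _; rewrite big_split /=.
by congr (_ * _); apply: eq_bigr => j _; rewrite mnmE.
Qed.

Lemma taylor_mon_eq0 (S : comNzRingType) (v : 'I_k -> S) (mon u : 'X_{1..k}) j :
  (u j < mon j)%N -> taylor_mon v mon u = 0.
Proof. by move=> lt; rewrite /taylor_mon (bigD1 j) //= bin_small // mulr0n mul0r. Qed.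

Lemma taylor_mon_scale (S : comNzRingType) (l : S) (v : 'I_k -> S) mon u :
  taylor_mon (fun j => l * v j) mon u =
  l ^+ (mdeg u - mdeg mon) * taylor_mon v mon u.
Proof.
have [/forallP le|] := boolP [forall j, (mon j <= u j)%N]; last first.
  rewrite negb_forall => /existsP[j]; rewrite -ltnNge => lt.
  by rewrite !(taylor_mon_eq0 _ lt) mulr0.
have -> : (mdeg u - mdeg mon = \sum_(j < k) (u j - mon j))%N.
  by rewrite !mdegE sumnB // => j _; apply: le.
rewrite /taylor_mon -prodrXr -big_split /=; apply: eq_bigr => j _.
by rewrite exprMn mulrnAr.
Qed.

Lemma rmorph_taylor_mon (S T : comNzRingType) (iota : {rmorphism S -> T}) v mon u :
  iota (taylor_mon v mon u) = taylor_mon (fun j => iota (v j)) mon u.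
Proof.
by rewrite rmorph_prod; apply: eq_bigr => j _; rewrite rmorphMn rmorphXn.
Qed.

Variable F : fieldType.

(** Taylor expansion of f(l v + y) in any commutative F-algebra. The scalar [l] is 1 for plain
    translations and for dehomogenisation; a nonconstant [l] serves [vanishes_to_order_slice]. *)
Lemma homog_taylor (S : comNzRingType) (iota : {rmorphism F -> S}) d
    (f : {mpoly F[k]}) (l : S) (v : 'I_k -> F) (y : 'I_k -> S) :
  f \is d.-homog ->
  mmap iota (fun j => l * iota (v j) + y j) f =
  \sum_(e : {ffun 'I_k -> 'I_d.+1})
    l ^+ (d - mdeg (mnm_of_ffun e)) * iota (taylor_coef f v (mnm_of_ffun e))
      * \prod_(j < k) y j ^+ e j.
Proof.
move=> /dhomogP hf; rewrite /mmap.
transitivity (\sum_(u <- msupp f) \sum_(e : {ffun 'I_k -> 'I_d.+1})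
   iota (f@_u) * (l ^+ (d - mdeg (mnm_of_ffun e)) *
      iota (taylor_mon v (mnm_of_ffun e) u) * \prod_(j < k) y j ^+ e j)).
  apply: eq_big_seq => u /hf du; rewrite -mulr_sumr; congr (_ * _).
  rewrite /mmap1 (@prod_exprD _ _ _ _ d) ?du //; apply: eq_bigr => e _.
  by rewrite taylor_mon_scale du rmorph_taylor_mon.
rewrite exchange_big; apply: eq_bigr => e _.
rewrite /taylor_coef rmorph_sum mulr_sumr mulr_suml; apply: eq_bigr => u _.
by rewrite rmorphM /=; ring.
Qed.

Lemma mcoeff_shift d (f : {mpoly F[k]}) (v : 'rV[F]_k) mon : f \is d.-homog ->
  (f \mPo [tuple (v ord0 i)%:MP + 'X_i | i < k])@_mon =
  taylor_coef f (v ord0) mon.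
Proof.
move=> hf.
have -> : f \mPo [tuple (v ord0 i)%:MP + 'X_i | i < k] =
    mmap (@mpolyC k F) (fun j => 1 * (v ord0 j)%:MP + 'X_j) f.
  apply: eq_bigr => u _; congr (_ * _); apply: mmap1_eq => j.
  by rewrite tnth_mktuple mul1r.
rewrite (homog_taylor _ _ _ _ hf).
have prodX (e : {ffun 'I_k -> 'I_d.+1}) :
    \prod_(j < k) 'X_j ^+ e j = 'X_[mnm_of_ffun e] :> {mpoly F[k]}.
  by rewrite mpolyXE_id; apply: eq_bigr => j _; rewrite mnmE.
rewrite linear_sum /=.
under eq_bigr do rewrite expr1n mul1r prodX mcoeffCM mcoeffX.
have [/forallP le|] := boolP [forall j, (mon j <= d)%N].
  pose e0 := [ffun j => Ordinal (le j : (mon j < d.+1)%N)].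
  have e0E : mnm_of_ffun e0 = mon by apply/mnmP => j; rewrite mnmE ffunE.
  rewrite (bigD1 e0) //= e0E eqxx mulr1 big1 ?addr0 // => e ne.
  case: eqP => [E|]; rewrite ?mulr0 //; case/eqP: ne; apply/ffunP => j.
  by apply: val_inj; rewrite /= ffunE /= -E mnmE.
rewrite negb_forall => /existsP[j]; rewrite -ltnNge => lt.
rewrite big1; last first.
  move=> e _; case: eqP => [E|]; rewrite ?mulr0 //.
  by move: lt; rewrite -E mnmE ltnNge -ltnS ltn_ord.
rewrite /taylor_coef big1_seq // => u /andP[_ /(dhomog_mf hf) du].
rewrite (@taylor_mon_eq0 _ _ _ _ j) ?mulr0 //.
by apply: leq_ltn_trans lt; rewrite -du /= mdegE (bigD1 j) //= leq_addr.
Qed.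

(** Turns the order of vanishing into equations linear in the coefficients of [f]. *)
Lemma vanishes_to_orderP d (f : {mpoly F[k]}) (v : 'rV[F]_k) m : f \is d.-homog ->
  vanishes_to_order f v m <->
  forall mon, (mdeg mon < m)%N -> taylor_coef f (v ord0) mon = 0.
Proof.
move=> hf; split=> [h mon lt|h mon].
  rewrite -(mcoeff_shift _ _ hf); apply/eqP; rewrite mcoeff_eq0.
  by apply: contraL lt => /h; rewrite -leqNgt.
rewrite mcoeff_msupp (mcoeff_shift _ _ hf) leqNgt; apply: contra => lt.
by rewrite h.
Qed.

End Taylor.

(** * Forms vanishing on a grid *)

Section GridForm.
Variable F : fieldType.

Lemma tower_prod_recr n (e : nat -> nat) (b : nat -> F) :
  \prod_(j < n.+1) (tvar F n.+1 j - tconst F n.+1 (b j)) ^+ e j =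
  (\prod_(j < n) (tvar F n j - tconst F n (b j)) ^+ e j)%:P
    * ('X - (tconst F n (b n))%:P) ^+ e n :> {poly tower F n}.
Proof.
rewrite big_ord_recr /= eqxx rmorph_prod /=; congr (_ * _).
by apply: eq_bigr => j _; rewrite ltn_eqF // rmorphXn rmorphB.
Qed.

Lemma tvar_prod_recr n (e : nat -> nat) :
  \prod_(j < n.+1) tvar F n.+1 j ^+ e j =
  (\prod_(j < n) tvar F n j ^+ e j)%:P * 'X ^+ e n :> {poly tower F n}.
Proof.
have z N (j : 'I_N) : tvar F N j ^+ e j = (tvar F N j - tconst F N 0) ^+ e j.
  by rewrite rmorph0 subr0.
under eq_bigr do rewrite z; rewrite (@tower_prod_recr n e (fun=> 0)) rmorph0 subr0.
by congr (_%:P * _); apply: eq_bigr => j _; rewrite subr0.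
Qed.

Lemma tord_ge_prod n m a (e : nat -> nat) : (m <= \sum_(j < n) e j)%N ->
  tord_ge a m (\prod_(j < n) (tvar F n j - tconst F n (a j)) ^+ e j).
Proof.
elim: n m => [|n IH] m; first by rewrite !big_ord0 /= leqn0 => /eqP->.
rewrite big_ord_recr /= => le i.
rewrite tower_prod_recr comp_polyM comp_polyC rmorphXn /= comp_polyB comp_polyX.
rewrite comp_polyC addrK coefCM coefXn; have [->|] := eqVneq i (e n).
  by rewrite mulr1; apply: IH; rewrite leq_subLR addnC.
by rewrite mulr0 => _; apply: tord_ge0.
Qed.

Lemma tdeg_lt_prod n d (e : nat -> nat) : (\sum_(j < n) e j < d)%N ->
  tdeg_lt d (\prod_(j < n) tvar F n j ^+ e j).
Proof.
elim: n d => [|n IH] d; first by rewrite !big_ord0 /= => d0 dE; rewrite dE in d0.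
rewrite big_ord_recr /= => lt i; rewrite tvar_prod_recr coefCM coefXn.
have [->|] := eqVneq i (e n); last by rewrite mulr0 => _; apply: tdeg_lt0.
by rewrite mulr1; apply: IH; rewrite ltn_subRL addnC.
Qed.

Lemma tcoefD n e (f g : tower F n) : tcoef e (f + g) = tcoef e f + tcoef e g.
Proof. by elim: n f g => //= n IH f g; rewrite coefD IH. Qed.

Lemma tcoef0 n e : tcoef e (0 : tower F n) = 0.
Proof. by elim: n => //= n IH; rewrite coef0 IH. Qed.

Lemma tcoef_prod n (e e' : nat -> nat) c :
  tcoef e (tconst F n c * \prod_(j < n) tvar F n j ^+ e' j) =
  c * [forall j : 'I_n, e j == e' j]%:R.
Proof.
elim: n => [|n IH].
  by rewrite big_ord0 /=; case: forallP => // -[] [].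
rewrite tvar_prod_recr /= mulrA -polyCM coefCM coefXn.
have [en|ne] := eqVneq (e n) (e' n).
  rewrite mulr1 IH; congr (c * _%:R); congr nat_of_bool.
  apply/forallP/forallP => h j; last exact: (h (widen_ord (leqnSn n) j)).
  have [jn|nj] := ltnP j n; first exact: (h (Ordinal jn)).
  by have -> : j = n :> nat; [have := ltn_ord j; lia | apply/eqP].
rewrite mulr0 tcoef0; case: forallP => [/(_ ord_max)/=|_]; last by rewrite mulr0.
by rewrite (negPf ne).
Qed.

Variable n : nat.

Definition dehomog_var (j : 'I_n.+1) : tower F n :=
  if (j : nat) is j'.+1 then tvar F n j' else 1.

Definition dehomog (f : {mpoly F[n.+1]}) : tower F n :=
  mmap (tconst F n) dehomog_var f.

Definition affine_point (a : nat -> F) : 'rV[F]_n.+1 :=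
  \row_(j < n.+1) (if (j : nat) is j'.+1 then a j' else 1).

Let tail (u : 'X_{1..n.+1}) (j : nat) : nat := u (inord j.+1).

Lemma tail_lift u (j : 'I_n) : tail u j = u (lift ord0 j).
Proof. by congr (u _); apply: val_inj; rewrite /= inordK // ltnS ltn_ord. Qed.

Lemma mdeg_tail u : mdeg u = (u ord0 + \sum_(j < n) tail u j)%N.
Proof.
by rewrite mdegE big_ord_recl; congr addn; apply: eq_bigr => j _; rewrite tail_lift.
Qed.

Lemma dehomogE f : dehomog f =
  \sum_(u <- msupp f) tconst F n f@_u * \prod_(j < n) tvar F n j ^+ tail u j.
Proof.
apply: eq_bigr => u _; congr (_ * _); rewrite /mmap1 big_ord_recl expr1n mul1r.
by apply: eq_bigr => j _; rewrite tail_lift.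
Qed.

Lemma tdeg_lt_dehomog d f : f \is d.-homog -> tdeg_lt d.+1 (dehomog f).
Proof.
move=> hf; rewrite dehomogE big_seq; apply: tdeg_lt_sum => u /(dhomog_mf hf) /= du.
by apply/tdeg_lt_constM/tdeg_lt_prod; rewrite ltnS -du mdeg_tail leq_addl.
Qed.

(** In fixed degree the exponents of the other variables determine that of x_0, so no two monomials
    merge. *)
Lemma dehomog_inj d f : f \is d.-homog -> dehomog f = 0 -> f = 0.
Proof.
move=> hf f0; apply/mpolyP => u; rewrite mcoeff0.
have [uf|/memN_msupp_eq0 //] := boolP (u \in msupp f).
have := congr1 (tcoef (tail u)) f0; rewrite tcoef0 dehomogE.
rewrite (big_morph _ (tcoefD _) (tcoef0 _ _)) => <-.
rewrite (bigD1_seq u) ?msupp_uniq //= tcoef_prod.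
have -> : [forall j : 'I_n, tail u j == tail u j] by apply/forallP => j.
rewrite mulr1 -[LHS]addr0; congr (_ + _); rewrite big1_seq // => w /andP[wu wf].
rewrite tcoef_prod; case: forallP => [h|_]; rewrite ?mulr0 //; case/eqP: wu.
have /eqP : mdeg w = mdeg u by rewrite (dhomog_mf hf wf) (dhomog_mf hf uf).
rewrite !mdeg_tail (eq_bigr (fun j : 'I_n => tail u j)); last first.
  by move=> j _; apply/esym/eqP/h.
rewrite eqn_add2r => /eqP w0; apply/mnmP => j.
case: (unliftP ord0 j) => [j'|] -> //.
by rewrite -!tail_lift; apply/esym/eqP/h.
Qed.

Lemma tord_ge_dehomog d f a m : f \is d.-homog ->
  vanishes_to_order f (affine_point a) m -> tord_ge a m (dehomog f).
Proof.
move=> hf /(vanishes_to_orderP _ _ hf) vf.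
pose v := affine_point a ord0.
have -> : dehomog f = mmap (tconst F n)
    (fun j => 1 * tconst F n (v j) + (dehomog_var j - tconst F n (v j))) f.
  apply: eq_bigr => u _; congr (_ * _); apply: mmap1_eq => j.
  by rewrite mul1r addrC subrK.
rewrite (homog_taylor _ _ _ _ hf); apply: tord_ge_sum => e _; set u := mnm_of_ffun e.
rewrite expr1n mul1r; have [lt|ge] := ltnP (mdeg u) m.
  by rewrite vf // rmorph0 mul0r; apply: tord_ge0.
rewrite big_ord_recl /= /v mxE /= rmorph1 subrr.
(* The displacement in the coordinate x_0 is 1 - 1 = 0, so only terms free of it survive. *)
have [e0|e0] := eqVneq (e ord0 : nat) 0%N; last first.
  by rewrite expr0n (negPf e0) mul0r mulr0; apply: tord_ge0.
apply: tord_ge_constM; rewrite e0 mul1r.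
under eq_bigr => j _ do
  rewrite mxE /= -(mnmE (fun i => e i : nat) (lift ord0 j)) -tail_lift.
apply: tord_ge_prod; apply: leq_trans ge _.
by rewrite mdeg_tail mnmE e0.
Qed.

Lemma grid_form_eq0 (A : seq F) d m f : uniq A -> (d < size A * m)%N ->
  f \is d.-homog ->
  (forall a, (forall j, a j \in A) -> vanishes_to_order f (affine_point a) m) ->
  f = 0.
Proof.
move=> uA dAm hf vf; apply: (dehomog_inj hf).
apply: (@grid_eq0 _ A n m) => //; first exact: tdeg_ltW dAm (tdeg_lt_dehomog hf).
by move=> a aA; apply: tord_ge_dehomog hf (vf a aA).
Qed.

End GridForm.

(** * The interpolation matrix *)

Section Forms.
Variables n d : nat.

(** The monomials of degree d, encoded as tuples whose number is known to be a binomial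
    coefficient. *)
Definition expo : finType :=
  {t : n.+1.-tuple 'I_d.+1 | \sum_(i <- t) (i : nat) == d}.

Definition mnm_of_expo (t : expo) : 'X_{1..n.+1} :=
  [multinom (tnth (val t) j : nat) | j < n.+1].

Lemma card_expo : #|{: expo}| = 'C(n + d, n).
Proof. by rewrite card_sig -card_ord_partitions cardsE. Qed.

Lemma mdeg_expo t : mdeg (mnm_of_expo t) = d.
Proof.
rewrite mdegE -[RHS](eqP (valP t)) big_tuple.
by apply: eq_bigr => j _; rewrite mnmE.
Qed.

Lemma mnm_of_expo_inj : injective mnm_of_expo.
Proof.
move=> t t' /mnmP E; apply/val_inj/eq_from_tnth => j; apply: val_inj.
by have := E j; rewrite !mnmE.
Qed.

Lemma mnm_of_expo_surj u : mdeg u = d -> exists t, mnm_of_expo t = u.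
Proof.
move=> du; have le j : (u j < d.+1)%N.
  by rewrite ltnS -du mdegE (bigD1 j) //= leq_addr.
pose t := [tuple Ordinal (le j) | j < n.+1].
have tP : \sum_(i <- t) (i : nat) == d.
  rewrite big_tuple; apply/eqP/(etrans _ du); rewrite mdegE.
  by apply: eq_bigr => j _; rewrite tnth_mktuple.
exists (exist _ t tP); apply/mnmP => j.
by rewrite mnmE /= tnth_mktuple.
Qed.

Variable F : fieldType.

Definition form_of (x : expo -> F) : {mpoly F[n.+1]} :=
  \sum_t x t *: 'X_[mnm_of_expo t].

Lemma form_of_homog x : form_of x \is d.-homog.
Proof.
apply: rpred_sum => t _; apply: rpredZ; rewrite dhomogX; exact/eqP/mdeg_expo.
Qed.

Lemma mcoeff_form_of x t : (form_of x)@_(mnm_of_expo t) = x t.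
Proof.
rewrite linear_sum (bigD1 t) //= mcoeffZ mcoeffX eqxx mulr1 big1 ?addr0 // => t' ne.
by rewrite mcoeffZ mcoeffX (inj_eq mnm_of_expo_inj) (negPf ne) mulr0.
Qed.

(** Replaces the support of [f] by an index set depending only on the degree, as a matrix needs. *)
Lemma taylor_coef_homog f v mon : f \is d.-homog ->
  taylor_coef f v mon =
  \sum_t f@_(mnm_of_expo t) * taylor_mon v mon (mnm_of_expo t) :> F.
Proof.
move=> hf; rewrite /taylor_coef.
pose G u := f@_u * taylor_mon v mon u.
have -> : \sum_t G (mnm_of_expo t) = \sum_(u <- [seq mnm_of_expo t | t : expo]) G u.
  by rewrite big_map big_enum.
rewrite [RHS](bigID (fun u => u \in msupp f)) /= [X in _ + X]big1 ?addr0; last first.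
  by move=> u /memN_msupp_eq0 fu; rewrite /G fu mul0r.
rewrite -[RHS]big_filter; apply: perm_big; apply: uniq_perm; first exact: msupp_uniq.
  by rewrite filter_uniq // map_inj_uniq ?enum_uniq //; exact: mnm_of_expo_inj.
move=> u; rewrite mem_filter; case uf: (u \in msupp f) => //=.
have [t <-] := mnm_of_expo_surj (dhomog_mf hf uf).
by rewrite map_f ?mem_enum.
Qed.

End Forms.

(** * Multidegrees in the coordinates of the points *)

Section Multihomogeneous.
Variables (F : fieldType) (s n : nat).
Implicit Types (D E : 'I_s -> nat) (f g : {mpoly F[s * n.+1]}).

Definition multidegree D f := forall mon, mon \in msupp f ->
  forall i : 'I_s, (\sum_(j < n.+1) mon (mxvec_index i j))%N = D i.

Lemma multidegree0 D : multidegree D 0.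
Proof. by move=> mon; rewrite msupp0. Qed.

Lemma multidegreeC c : multidegree (fun=> 0%N) c%:MP.
Proof.
move=> mon; rewrite msuppC; case: ifP => // _; rewrite inE => /eqP-> i.
by apply: big1 => j _; rewrite mnm0E.
Qed.

Lemma multidegreeX i0 j0 :
  multidegree (fun i => (i == i0 : nat)) 'X_(mxvec_index i0 j0).
Proof.
move=> mon; rewrite msuppX inE => /eqP-> i.
have idx_inj : injective (uncurry (@mxvec_index s n.+1)).
  by move=> [? ?] [? ?] /cast_ord_inj/enum_rank_inj.
under eq_bigr do rewrite mnm1E (inj_eq idx_inj (i0, j0) (i, _)) xpair_eqE.
rewrite (bigD1 j0) //= eqxx andbT eq_sym big1 ?addn0 // => j /negPf.
by rewrite eq_sym => ->; rewrite andbF.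
Qed.

Lemma multidegreeD D f g : multidegree D f -> multidegree D g ->
  multidegree D (f + g).
Proof. by move=> hf hg mon /msuppD_le; rewrite mem_cat => /orP[/hf|/hg]. Qed.

Lemma multidegreeM D E f g : multidegree D f -> multidegree E g ->
  multidegree (fun i => (D i + E i)%N) (f * g).
Proof.
move=> hf hg mon /msuppM_le/allpairsP[[u w]] /= [/hf hu /hg hw ->] i.
by under eq_bigr do rewrite mnmDE; rewrite big_split /= hu hw.
Qed.

Lemma multidegree_sum D I (r : seq I) (P : pred I) (f : I -> {mpoly F[s * n.+1]}) :
  (forall k, P k -> multidegree D (f k)) ->
  multidegree D (\sum_(k <- r | P k) f k).
Proof.
move=> h; elim/big_rec: _ => [|k x Pk hx]; first exact: multidegree0.
by apply: multidegreeD hx; apply: h.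
Qed.

Lemma multidegree_prod I (r : seq I) (D : I -> 'I_s -> nat)
    (f : I -> {mpoly F[s * n.+1]}) : (forall k, multidegree (D k) (f k)) ->
  multidegree (fun i => \sum_(k <- r) D k i)%N (\prod_(k <- r) f k).
Proof.
move=> h; elim: r => [|k r IH].
  by rewrite big_nil => mon mon1 i; rewrite big_nil (multidegreeC mon1).
rewrite big_cons => mon /(multidegreeM (h k) IH) E i.
by rewrite big_cons E.
Qed.

Lemma multidegree_exp D f e : multidegree D f ->
  multidegree (fun i => (e * D i)%N) (f ^+ e).
Proof.
move=> hf; elim: e => [|e IH].
  by rewrite expr0 => mon mon1 i; rewrite (multidegreeC mon1).
by rewrite exprS => mon /(multidegreeM hf IH) E i; rewrite E mulSn.
Qed.

Lemma multidegree_mulrn D f e : multidegree D f -> multidegree D (f *+ e).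
Proof.
by move=> hf; rewrite -mulr_natl -mpolyC_nat; exact: multidegreeM (@multidegreeC _) hf.
Qed.

(** Each term of the Leibniz formula takes one entry from every row, so row degrees add up
    independently of the permutation. *)
Lemma multidegree_det N (D : 'I_N -> 'I_s -> nat) (A : 'M[{mpoly F[s * n.+1]}]_N) :
  (forall k c, multidegree (D k) (A k c)) ->
  multidegree (fun i => \sum_(k < N) D k i)%N (\det A).
Proof.
move=> h; apply: multidegree_sum => sg _.
have -> : (-1) ^+ sg = ((-1) ^+ sg)%:MP :> {mpoly F[s * n.+1]}.
  by rewrite rmorphXn rmorphN rmorph1.
apply: (@multidegreeM (fun=> 0%N) (fun i => \sum_(k < N) D k i)%N).
  exact: multidegreeC.
exact: (@multidegree_prod _ _ D (fun k => A k (sg k))) (fun k => h k (sg k)).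
Qed.

Lemma multidegree_taylor_mon (i0 : 'I_s) (mon u : 'X_{1..n.+1}) :
  multidegree (fun i => (i == i0) * (mdeg u - mdeg mon))%N
    (taylor_mon (fun j => 'X_(mxvec_index i0 j)) mon u).
Proof.
have [/forallP le|] := boolP [forall j, (mon j <= u j)%N]; last first.
  rewrite negb_forall => /existsP[j]; rewrite -ltnNge => /taylor_mon_eq0->.
  exact: multidegree0.
have h (j : 'I_n.+1) : multidegree (fun i => (u j - mon j) * (i == i0))%N
    ('X_(mxvec_index i0 j) ^+ (u j - mon j) *+ 'C(u j, mon j)).
  by apply/multidegree_mulrn/multidegree_exp/multidegreeX.
move=> w /(multidegree_prod h) E i; rewrite E -big_distrl mulnC /=.
by rewrite !mdegE sumnB // => j _; apply: le.
Qed.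

End Multihomogeneous.

Section Generic.
Variables (F : fieldType) (s n d m : nat).

Definition no_form (p : 'M[F]_(s, n.+1)) := forall f : {mpoly F[n.+1]},
  f \is d.-homog -> (forall i, vanishes_to_order f (row i p) m) -> f = 0.

Let rows : finType := ('I_s * 'X_{1..n.+1 < m})%type.
Let N := #|{: expo n d}|.
Let pt (k : 'I_#|{: rows}|) : 'I_s := (enum_val k).1.
Let jet (k : 'I_#|{: rows}|) : 'X_{1..n.+1} := (enum_val k).2.
Let colmon (c : 'I_N) : 'X_{1..n.+1} := mnm_of_expo (enum_val c).

Definition interpolation_mx (p : 'M[F]_(s, n.+1)) : 'M[F]_(#|{: rows}|, N) :=
  \matrix_(k, c) taylor_mon (p (pt k)) (jet k)
     (colmon c).

Lemma interpolation_mxE p f k : f \is d.-homog ->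
  (interpolation_mx p *m \col_c f@_(colmon c)) k ord0 =
  taylor_coef f (p (pt k)) (jet k).
Proof.
move=> hf; rewrite mxE (taylor_coef_homog _ _ hf).
rewrite (reindex (fun c : 'I_N => enum_val c)) /=.
  by apply: eq_bigr => c _; rewrite !mxE mulrC.
exact: onW_bij (enum_val_bij (expo n d)).
Qed.

Lemma vanishing_interpolation p f : f \is d.-homog ->
  interpolation_mx p *m \col_c f@_(colmon c) = 0 <->
  forall i, vanishes_to_order f (row i p) m.
Proof.
move=> hf; split=> [E i|vf].
  apply/(vanishes_to_orderP _ _ hf) => mon lt.
  pose k := enum_rank (i, BMultinom lt).
  have := interpolation_mxE p k hf; rewrite E /pt /jet enum_rankK mxE /= => ->.
  by rewrite /row; congr (taylor_coef f _ mon); apply/funext => j; rewrite mxE.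
apply/colP => k; rewrite interpolation_mxE // mxE.
rewrite /pt /jet; case: (enum_val k) => i mon /=.
have /(vanishes_to_orderP _ _ hf) := vf i.
move=> /(_ mon (bmdeg mon)) <-.
by congr (taylor_coef f _ mon); apply/funext => j; rewrite mxE.
Qed.

(** A vector in the kernel of the matrix is the coefficient vector of a form vanishing to order [m]
    at all the points. *)
Lemma no_form_row_full p : no_form p -> row_full (interpolation_mx p).
Proof.
move=> nf; rewrite -[row_full _]/(\rank _ == _) -mxrank_tr.
apply: inj_row_free => x xM; pose f := form_of (fun t => x ord0 (enum_rank t)).
have xE : \col_c f@_(colmon c) = x^T.
  by apply/colP => c; rewrite !mxE /colmon mcoeff_form_of enum_valK.
have hf : f \is d.-homog by apply: form_of_homog.
have f0 : f = 0.
  apply: nf => //; apply/vanishing_interpolation => //; rewrite xE.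
  by rewrite -[interpolation_mx p]trmxK -trmx_mul xM trmx0.
by apply: trmx_inj; rewrite -xE f0; apply/colP => c; rewrite !mxE mcoeff0.
Qed.

(* The closed set is the vanishing locus of one maximal minor of the           *)
(* interpolation matrix, chosen to be nonzero at p0.                           *)
Lemma no_form_generic p0 : points_tuple p0 -> no_form p0 ->
  exists2 Z, proper_zariski_closed Z &
    forall p, points_tuple p -> ~ Z p -> no_form p.
Proof.
move=> hp0 /no_form_row_full full; pose g := fullrankfun full.
pose A : 'M[{mpoly F[s * n.+1]}]_N := \matrix_(k, c)
  taylor_mon (fun j => 'X_(mxvec_index (pt (g k)) j)) (jet (g k))
    (colmon c).
have detA p : (\det A).@[fun k => mxvec p ord0 k] =
    \det (rowsub g (interpolation_mx p)).
  rewrite -det_map_mx; congr (\det _); apply/matrixP => k c.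
  rewrite !mxE rmorph_taylor_mon; congr (taylor_mon _ _ _).
  by apply/funext => j; rewrite /= mevalXU mxvecE.
exists (zero_locus [set \det A]%classic).
  split; last exists p0 => //.
    exists [set \det A]%classic; split=> // _ ->.
    exists (fun i => \sum_(k < N) (i == (pt (g k))) *
      (d - mdeg (jet (g k))))%N.
    apply: multidegree_det => k c; rewrite mxE.
    have := @multidegree_taylor_mon F s n (pt (g k)) (jet (g k)) (colmon c).
    by rewrite mdeg_expo.
  move=> [_ /(_ _ erefl)]; rewrite detA => /eqP; apply/negP.
  by rewrite -unitfE -unitmxE fullrowsub_unit.
move=> p hp Zp f hf /(vanishing_interpolation _ hf) E.
have unitB : rowsub g (interpolation_mx p) \in unitmx.
  rewrite unitmxE unitfE; apply/eqP => D0; apply: Zp; split=> // _ ->.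
  by rewrite detA.
(* The selected rows alone form an invertible system, which forces all coefficients of [f] to be
   zero. *)
have := congr1 (rowsub g) E; rewrite -mul_rowsub_mx.
move=> /(congr1 (mulmx (invmx (rowsub g (interpolation_mx p))))).
rewrite mulKmx // => x0.
apply/mpolyP => u; rewrite mcoeff0.
have [uf|/memN_msupp_eq0 //] := boolP (u \in msupp f).
have [t <-] := mnm_of_expo_surj (dhomog_mf hf uf).
have := congr1 (fun B : 'cV_N => B (enum_rank t) ord0) x0.
by rewrite mxE /colmon enum_rankK => ->; rewrite !mxE big1 // => k _; rewrite !mxE mulr0.
Qed.

End Generic.

(** * Existence of forms *)

Section LowestDegree.
Variables (F : fieldType) (k : nat).
Implicit Types f g : {mpoly F[k]}.

(** Applied to the translate f(v + X), this is [vanishes_to_order f v m] by conversion. *)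
Definition mindeg_ge m f := forall mon, mon \in msupp f -> (m <= mdeg mon)%N.

Lemma mindeg_ge_trivial f : mindeg_ge 0 f.
Proof. by []. Qed.

Lemma mindeg_geM a b f g : mindeg_ge a f -> mindeg_ge b g ->
  mindeg_ge (a + b) (f * g).
Proof.
move=> hf hg mon /msuppM_le/allpairsP[[u w]] /= [/hf hu /hg hw ->].
by rewrite mdegD leq_add.
Qed.

Lemma mindeg_ge_exp a f e : mindeg_ge a f -> mindeg_ge (e * a) (f ^+ e).
Proof.
move=> hf; elim: e => [|e IH]; first exact: mindeg_ge_trivial.
by rewrite exprS mulSn; apply: mindeg_geM.
Qed.

Lemma mindeg_ge_prod I (r : seq I) (a : I -> nat) (f : I -> {mpoly F[k]}) :
  (forall i, mindeg_ge (a i) (f i)) ->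
  mindeg_ge (\sum_(i <- r) a i) (\prod_(i <- r) f i).
Proof.
move=> h; elim: r => [|i r IH]; first by rewrite big_nil; exact: mindeg_ge_trivial.
by rewrite !big_cons; apply: mindeg_geM.
Qed.

Lemma mindeg_geXU (i : 'I_k) : mindeg_ge 1 'X_i.
Proof. by move=> mon; rewrite msuppX inE => /eqP->; rewrite mdeg1. Qed.

Lemma mindeg_geB a f g : mindeg_ge a f -> mindeg_ge a g -> mindeg_ge a (f - g).
Proof. by move=> hf hg mon /msuppB_le; rewrite mem_cat => /orP[/hf|/hg]. Qed.

(* By homogeneity c^d f(v + X) = f(c v + c X) where c = v j0, and              *)
(* c v + c X = L v + Y with L = c + X_j0 and Y_j = c X_j - v_j X_j0. As        *)
(* Y_j0 = 0, only the Taylor coefficients free of X_j0 contribute.             *)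
Lemma vanishes_to_order_slice d f (v : 'rV[F]_k) (j0 : 'I_k) m :
  f \is d.-homog -> v ord0 j0 != 0 ->
  (forall mon : 'X_{1..k}, mon j0 = 0%N -> (mdeg mon < m)%N ->
     taylor_coef f (v ord0) mon = 0) ->
  vanishes_to_order f v m.
Proof.
move=> hf c0 h; apply/(vanishes_to_orderP _ _ hf) => mon lt.
rewrite -(mcoeff_shift _ _ hf); set c := v ord0 j0 in c0.
apply/(mulfI (expf_neq0 d c0)); rewrite mulr0 -mcoeffCM.
pose Y j : {mpoly F[k]} := c%:MP * 'X_j - (v ord0 j)%:MP * 'X_j0.
have -> : (c ^+ d)%:MP * (f \mPo [tuple (v ord0 i)%:MP + 'X_i | i < k]) =
    mmap (@mpolyC k F) (fun j => (c%:MP + 'X_j0) * (v ord0 j)%:MP + Y j) f.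
  rewrite /comp_mpoly /mmap mulr_sumr; apply: eq_big_seq => u /(dhomog_mf hf) /= du.
  rewrite mulrCA; congr (_ * _); rewrite /mmap1 rmorphXn -du mdegE -prodrXr.
  rewrite -big_split /=; apply: eq_bigr => j _.
  by rewrite -exprMn tnth_mktuple; congr (_ ^+ _); rewrite /Y; ring.
rewrite (homog_taylor _ _ _ _ hf) linear_sum /= big1 // => e _.
set w := mnm_of_ffun e; have [wm|mw] := ltnP (mdeg w) m.
  have [w0|w0] := eqVneq (w j0) 0%N; first by rewrite h // mulr0 mul0r mcoeff0.
  rewrite (bigD1 j0) //= {1}/Y subrr expr0n; move: w0; rewrite mnmE => /negPf->.
  by rewrite mul0r mulr0 mcoeff0.
(* Every Y_j is linear, so a term with |w| >= m has no monomial of degree below m. *)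
apply/eqP; rewrite mcoeff_eq0; apply/negP.
have Yd j : mindeg_ge 1 (Y j).
  by apply: mindeg_geB; apply: (@mindeg_geM 0 1) (@mindeg_ge_trivial _) (@mindeg_geXU _).
have Ye j : mindeg_ge (e j) (Y j ^+ e j).
  by have := @mindeg_ge_exp 1 (Y j) (e j) (Yd j); rewrite muln1.
move=> /(mindeg_geM (@mindeg_ge_trivial _) (mindeg_ge_prod Ye)).
rewrite add0n => le; have := leq_ltn_trans le lt.
rewrite ltnNge => /negP[]; apply: leq_trans mw _; rewrite mdegE.
by apply: eq_leq; apply: eq_bigr => j _; rewrite mnmE.
Qed.

End LowestDegree.

Section Existence.
Variables (F : fieldType) (s n d m : nat).

(** The conditions at one point after slicing: monomials of degree at most m in the n variables
    other than a pivot, whence 'C(n + m, n) of them instead of the larger number in n + 1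
    variables. *)
Let jets : finType :=
  {t : n.-tuple 'I_m.+1 | \sum_(i <- t) (i : nat) <= m}%N.

Let slice_mnm (j0 : 'I_n.+1) (w : jets) : 'X_{1..n.+1} :=
  [multinom (if unlift j0 j is Some j' then tnth (val w) j' : nat else 0%N)
  | j < n.+1].

Let slice_mnm_surj j0 (mon : 'X_{1..n.+1}) : mon j0 = 0%N -> (mdeg mon < m.+1)%N ->
  exists w, slice_mnm j0 w = mon.
Proof.
move=> mon0 lt.
have degE : mdeg mon = (\sum_(j < n) mon (lift j0 j))%N.
  by rewrite mdegE (bigD1_ord j0) //= mon0.
have le j : (mon (lift j0 j) < m.+1)%N.
  by apply: leq_ltn_trans lt; rewrite degE (bigD1 j) //= leq_addr.
pose t := [tuple Ordinal (le j) | j < n].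
have tP : (\sum_(i <- t) (i : nat) <= m)%N.
  rewrite big_tuple -ltnS; apply: leq_trans lt; rewrite ltnS degE.
  by apply: eq_leq; apply: eq_bigr => j _; rewrite tnth_mktuple.
exists (exist _ t tP); apply/mnmP => j; rewrite mnmE.
by case: unliftP => [j'|] -> //=; rewrite tnth_mktuple.
Qed.

(** Fewer linear conditions than coefficients; at each point the slice omits a coordinate that is
    nonzero there. *)
Lemma exists_form (p : 'M[F]_(s, n.+1)) : points_tuple p ->
  (s * 'C(n + m, n) < 'C(n + d, n))%N ->
  exists f : {mpoly F[n.+1]}, [/\ f != 0, f \is d.-homog &
    forall i, vanishes_to_order f (row i p) m.+1].
Proof.
move=> hp lt.
have pivot i : exists j, p i j != 0.
  by have /rV0Pn[j] := hp i; rewrite mxE; exists j.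
pose j0 i := xchoose (pivot i).
pose cond : finType := ('I_s * jets)%type.
pose A : 'M[F]_(#|{: expo n d}|, #|{: cond}|) := \matrix_(c, k)
  taylor_mon (p (enum_val k).1) (slice_mnm (j0 (enum_val k).1) (enum_val k).2)
     (mnm_of_expo (enum_val c)).
have : kermx A != 0.
  rewrite kermx_eq0 -[row_free _]/(\rank A == _) neq_ltn; apply/orP; left.
  apply: leq_ltn_trans (rank_leq_col A) _.
  rewrite card_expo card_prod card_ord card_sig -cardsE.
  by rewrite card_partial_ord_partitions.
move=> /rowV0Pn[x /sub_kermxP xA x0].
pose f := form_of (fun t => x ord0 (enum_rank t)).
have hf : f \is d.-homog by apply: form_of_homog.
exists f; split=> //.
  apply: contraNneq x0 => f0; apply/eqP/rowP => c.
  rewrite mxE -[c]enum_valK -(mcoeff_form_of (fun t => x ord0 (enum_rank t))).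
  by rewrite -/f f0 mcoeff0.
move=> i; apply: (@vanishes_to_order_slice _ _ d _ _ (j0 i)) => //.
  by rewrite mxE; apply: (xchooseP (pivot i)).
move=> mon mon0 monlt; have [w <-] := slice_mnm_surj mon0 monlt.
have := congr1 (fun B : 'rV_(_) => B ord0 (enum_rank ((i, w) : cond))) xA.
rewrite !mxE => xA0; apply: etrans xA0; rewrite (taylor_coef_homog _ _ hf).
rewrite (reindex (fun c : 'I_#|{: expo n d}| => enum_val c)) /=; last first.
  exact: onW_bij (enum_val_bij (expo n d)).
apply: eq_bigr => c _; rewrite mcoeff_form_of enum_valK mxE enum_rankK /=.
by congr (_ * taylor_mon _ _ _); apply/funext => j; rewrite mxE.
Qed.

End Existence.

(** * Waldschmidt constants of very general points *)

Lemma closed_field_uniq_seq (F : closedFieldType) k :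
  exists A : seq F, uniq A /\ size A = k.
Proof.
elim: k => [|k [A [uA sA]]]; first by exists [::].
pose q : {poly F} := \prod_(a <- A) ('X - a%:P) + 1.
have [x qx] : exists x, x \notin A.
  (* For empty [A] the polynomial [q] is the constant 1 + 1, which need not have a root. *)
  case: k sA => [/size0nil->|k sA]; first by exists 0.
  have /closed_rootP[x] : size q != 1%N.
    by rewrite size_polyDl size_prod_XsubC sA // size_poly1.
  rewrite /root hornerD hornerE => qx; exists x; apply: contraTN qx.
  by rewrite -root_prod_XsubC => /rootP->; rewrite add0r oner_eq0.
by exists (x :: A); rewrite /= qx uA sA.
Qed.

Section Alpha.
Variables (F : fieldType) (k : nat) (J : set {mpoly F[k]}).

Lemma alpha_le d : has_form_of_deg J d -> (alpha J <= d)%N.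
Proof.
move=> hd; rewrite /alpha; case: pselect => [exJ|[]]; last by exists d; apply/asboolP.
by case: ex_minnP => a _; apply; apply/asboolP.
Qed.

Lemma alphaP d : has_form_of_deg J d -> has_form_of_deg J (alpha J).
Proof.
move=> hd; rewrite /alpha; case: pselect => [exJ|[]]; last by exists d; apply/asboolP.
by case: ex_minnP => a /asboolP.
Qed.

End Alpha.

Section Waldschmidt.
Variables (F : fieldType) (s n : nat).
Implicit Type p : 'M[F]_(s, n.+1).

Lemma symbolic_power_vanishes p m f i :
  symbolic_power p m f -> vanishes_to_order f (row i p) m.
Proof.
move=> [l [c [g [hg ->]]]]; rewrite -[vanishes_to_order _ _ _]/(mindeg_ge m _).
rewrite rmorph_sum; elim/big_rec: _ => [|j x _ hx]; first by move=> mon; rewrite msupp0.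
move=> mon /msuppD_le; rewrite mem_cat => /orP[|/hx //]; rewrite rmorphM.
move=> /(@mindeg_geM _ _ 0 m _ _ (@mindeg_ge_trivial _ _ _)); apply.
exact: (hg j).2.
Qed.

Lemma symbolic_power_form p m d f : f != 0 -> f \is d.-homog ->
  (forall i, vanishes_to_order f (row i p) m) ->
  has_form_of_deg (symbolic_power p m) d.
Proof.
move=> f0 hf vf; exists f; split=> //.
exists 1%N, (fun=> 1), (fun=> f); split; last by rewrite big_ord1 mul1r.
by move=> _; split=> //; exists d.
Qed.

Lemma alpha_symbolic_power_le p m d : points_tuple p ->
  (s * 'C(n + m, n) < 'C(n + d, n))%N ->
  (alpha (symbolic_power p m.+1) <= d)%N.
Proof.
move=> hp lt; have [f [f0 hf vf]] := exists_form hp lt.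
exact/alpha_le/symbolic_power_form/vf.
Qed.

(** Taking d to be the left side itself works because 'C(n + d, n) >= d + 1. Hence the symbolic
    powers contain nonzero forms, and [alpha] never takes its dummy value on them. *)
Lemma exists_degree m : (0 < n)%N -> exists d, (s * 'C(n + m, n) < 'C(n + d, n))%N.
Proof.
move=> n0; exists (s * 'C(n + m, n))%N; set d := (s * _)%N.
rewrite -[X in (X <= _)%N](binSn d) -[X in (_ <= X)%N]bin_sub ?leq_addr // addKn.
by apply: leq_bin2l; rewrite -add1n leq_add2r.
Qed.

Lemma waldschmidt_ge (R : realType) k p : (0 < n)%N -> points_tuple p ->
  (forall d m, (d < k * m)%N -> no_form d m p) ->
  k%:R <= waldschmidt R p.
Proof.
move=> n0 hp nf; apply: lb_le_inf.
  by exists ((alpha (symbolic_power p 1))%:R / 1); exists 1%N.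
move=> _ [m m1 ->]; rewrite ler_pdivlMr ?ltr0n // -natrM ler_nat leqNgt.
apply/negP => lt.
case: m m1 lt => // m _ lt; have [d hd] := exists_degree m n0.
have [f0 [g0 h0 w0]] := exists_form hp hd.
have [f [Jf fn0 hf]] := alphaP (symbolic_power_form g0 h0 w0).
move/eqP: fn0; apply; apply: (nf _ _ lt) => // i; exact: symbolic_power_vanishes.
Qed.

(** The first k^n points run through the grid in the chart x_0 = 1 and the remaining ones repeat the
    grid point [g0]; repetitions are harmless, since the tuple only witnesses that closed sets are
    proper. *)
Lemma exists_no_form_tuple k (A : seq F) : uniq A -> size A = k -> (0 < k)%N ->
  (k ^ n <= s)%N ->
  exists2 p0 : 'M[F]_(s, n.+1), points_tuple p0 &
    forall d m, (d < k * m)%N -> no_form d m p0.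
Proof.
move=> uA sA k0 kns; pose G : finType := {ffun 'I_n -> 'I_k}.
pose g0 : G := [ffun=> Ordinal k0].
pose pt (g : G) (j : nat) : F := if insub j is Some j' then nth 0 A (g j') else 0.
pose p0 : 'M[F]_(s, n.+1) := \matrix_(i < s) affine_point n (pt (nth g0 (enum G) i)).
exists p0.
  move=> i; rewrite rowK; apply/eqP => /rowP/(_ ord0)/eqP.
  by rewrite !mxE oner_eq0.
move=> d m lt f hf vf; apply: (@grid_form_eq0 _ _ A d m) => //; first by rewrite sA.
move=> a aA.
have idx j : (index (a j) A < k)%N by rewrite -sA index_mem.
pose g : G := [ffun j : 'I_n => Ordinal (idx j)].
have lti : (index g (enum G) < s)%N.
  apply: leq_trans kns; rewrite -[X in (_ < X ^ _)%N]card_ord.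
  rewrite -[X in (_ < _ ^ X)%N]card_ord.
  by rewrite -card_ffun cardE index_mem mem_enum.
have -> : affine_point n a = row (Ordinal lti) p0; last exact: vf.
rewrite rowK /= nth_index ?mem_enum //; apply/rowP => -[[|j] jn]; rewrite !mxE //=.
by rewrite /pt insubT //= ffunE /= nth_index.
Qed.

Lemma very_general_mono (P Q : 'M[F]_(s, n.+1) -> Prop) :
  (forall p, points_tuple p -> P p -> Q p) -> very_general P -> very_general Q.
Proof. by move=> PQ [Z [hZ h]]; exists Z; split=> // p hp dp nZ; apply/PQ/h. Qed.

End Waldschmidt.

Lemma very_general_waldschmidt_ge (R : realType) (F : closedFieldType) (s n k : nat) :
  (0 < n)%N -> (0 < k)%N -> (k ^ n <= s)%N ->
  very_general (fun p : 'M[F]_(s, n.+1) => k%:R <= waldschmidt R p).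
Proof.
move=> n0 k0 kns; have [A [uA sA]] := closed_field_uniq_seq F k.
have [p0 hp0 nf0] := exists_no_form_tuple uA sA k0 kns.
have /choice[Z hZ] (dm : nat * nat) : exists Z : set 'M[F]_(s, n.+1),
    proper_zariski_closed Z /\ forall p, points_tuple p -> ~ Z p ->
      (dm.1 < k * dm.2)%N -> no_form dm.1 dm.2 p.
  have [lt|_] := ltnP dm.1 (k * dm.2).
    have [Z pZ hZ] := no_form_generic hp0 (nf0 _ _ lt).
    by exists Z; split=> // p hp nZ _; apply: hZ.
  (* Nothing has to be excluded for this pair; the closed set of the pair (0, 1) serves as a proper
     filler. *)
  have k1 : (0 < k * 1)%N by rewrite muln1.
  by have [Z pZ _] := no_form_generic hp0 (nf0 _ _ k1); exists Z.
exists (fun i => Z (odflt (0%N, 0%N) (unpickle i))); split=> [i|p hp _ nZ].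
  exact: (hZ _).1.
apply: (waldschmidt_ge _ n0 hp) => d m lt; apply: ((hZ (d, m)).2 p hp _ lt).
by have := nZ (pickle (d, m)); rewrite pickleK.
Qed.

(** * The binomial inequality *)

Section Numerics.
Variable R : realType.

(* Pairing the factors i and n - 1 - i reduces the inequality between products *)
(* to  r^2 (B^2 - h^2) < A^2 - h^2,  where A and B are the sums of the paired  *)
(* factors and h is their common difference.                                   *)
Lemma binomial_lt (r : R) (n s m d : nat) : (0 < n)%N -> 1 <= r -> s%:R = r ^+ n ->
  r * (2 * m%:R + n%:R + 1) < 2 * d%:R + n%:R + 1 ->
  (s * 'C(n + m, n) < 'C(n + d, n))%N.
Proof.
move=> n0 r1 sr lt.
rewrite -(ltn_pmul2r (fact_gt0 n)) -mulnA !bin_ffact !ffact_prod.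
rewrite -(ltr_nat R) natrM sr !natr_prod -[X in r ^+ X]card_ord.
rewrite -prodr_const -big_split /=.
pose a (e : nat) (i : 'I_n) : R := e%:R + n%:R - i%:R.
have aE e (i : 'I_n) : (n + e - i)%:R = a e i.
  rewrite /a [e%:R + _]addrC -natrD natrB //.
  by apply: leq_trans (leq_addr _ _); apply: ltnW.
under eq_bigr do rewrite aE; under [ltRHS]eq_bigr do rewrite aE.
have r0 : 0 < r by apply: lt_le_trans r1.
have a0 e i : 0 < a e i.
  by rewrite -aE ltr0n subn_gt0 (leq_trans (ltn_ord i)) // leq_addr.
have arev e i : a e (rev_ord i) = e%:R + 1 + i%:R.
  by rewrite /a /= natrB // -natr1; ring.
(* After squaring, each product can be multiplied by its own reversal, so that no middle factor is
   left unpaired. *)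
rewrite -ltr_sqr ?nnegrE ?prodr_ge0 // => [|i _|i _]; last 2 first.
- by rewrite ltW ?mulr_gt0.
- by rewrite ltW ?mulr_gt0.
have sq (E : 'I_n -> R) :
    (\prod_(i < n) E i) ^+ 2 = \prod_(i < n) (E i * E (rev_ord i)).
  by rewrite expr2 {2}(reindex_inj rev_ord_inj) -big_split.
rewrite !sq; case: n n0 @a {sr} lt aE a0 arev sq => // n _ a lt aE a0 arev sq.
apply: ltr_prod => [|i _]; first by apply/hasP; exists ord0; rewrite ?mem_index_enum.
apply/andP; split; first by rewrite !mulr_ge0 // ltW.
rewrite !arev /a; set N : R := n.+1%:R; set x : R := i%:R.
pose A : R := 2 * d%:R + N + 1; pose B : R := 2 * m%:R + N + 1.
pose h : R := N - 1 - 2 * x.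
have -> : r * (m%:R + N - x) * (r * (m%:R + 1 + x)) =
    (r ^+ 2 * B ^+ 2 - r ^+ 2 * h ^+ 2) / 4.
  by rewrite /B /h; field.
have -> : (d%:R + N - x) * (d%:R + 1 + x) = (A ^+ 2 - h ^+ 2) / 4.
  by rewrite /A /h; field.
rewrite ltr_pM2r ?invr_gt0 ?ltr0n //; apply: ltr_leB; last first.
  by rewrite ler_peMl ?sqr_ge0 // exprn_ege1.
rewrite -exprMn ltr_sqr ?nnegrE //.
  by rewrite mulr_ge0 ?(ltW r0) // /B !addr_ge0 // mulr_ge0.
by rewrite /A !addr_ge0 // mulr_ge0.
Qed.

End Numerics.

(** * Comparison with the integral part of the root *)

Section NthRoot.
Variables (R : realType) (n s : nat).
Hypotheses (n0 : (0 < n)%N) (s0 : (0 < s)%N).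
Let r : R := nth_root R n s.
Let k : nat := `|Num.floor r|%N.

Lemma nth_rootX : s%:R = r ^+ n.
Proof.
rewrite -powR_mulrn ?powR_ge0 // -powRrM mulVf ?pnatr_eq0 -?lt0n //.
by rewrite powRr1 // ler0n.
Qed.

Lemma nth_root_ge1 : 1 <= r.
Proof. by rewrite -(@expr_ge1 _ n) ?powR_ge0 // -nth_rootX ler1n. Qed.

Lemma floor_nth_root : (Num.floor r)%:~R = k%:R :> R.
Proof.
by rewrite -[LHS]ger0_norm -?intr_norm ?ler0z ?floor_ge0 ?powR_ge0 // pmulrn.
Qed.

Lemma floor_nth_root_gt0 : (0 < k)%N.
Proof. by rewrite absz_gt0 floor_neq0 nth_root_ge1 orbT. Qed.

Lemma floor_nth_rootX : (k ^ n <= s)%N.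
Proof.
rewrite -(ler_nat R) nth_rootX natrX lerXn2r ?nnegrE ?powR_ge0 //.
by rewrite -floor_nth_root floor_le.
Qed.

Lemma demailly_bound (F : fieldType) (p : 'M[F]_(s, n.+1)) m : (0 < m)%N ->
  r * (2 * m%:R + n%:R - 1) < 2 * k%:R * (m%:R + n%:R - 1) - n%:R + 3 ->
  points_tuple p -> k%:R <= waldschmidt R p ->
  ((alpha (symbolic_power p m))%:R + n%:R - 1) / (m%:R + n%:R - 1)
    <= waldschmidt R p.
Proof.
case: m => // m _ lt hp; apply: le_trans.
have mE : m.+1%:R + n%:R - 1 = (m + n)%:R :> R by rewrite -natr1 natrD; ring.
have mn0 : (0 < m + n)%N by rewrite addn_gt0 n0 orbT.
(* With [m] now standing for the order minus one, this is the degree for which (d + n - 1) / (m + n)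
   equals k; the subtraction is not truncated because k >= 1. *)
pose d := (k * (m + n) - n.-1)%N.
have dE : d%:R = k%:R * (m%:R + n%:R) - n%:R + 1 :> R.
  rewrite natrB; first by rewrite natrM natrD -subn1 natrB //; ring.
  have := floor_nth_root_gt0; nia.
have /(alpha_symbolic_power_le hp) le : (s * 'C(n + m, n) < 'C(n + d, n))%N.
  apply: (binomial_lt n0 nth_root_ge1 nth_rootX).
  by move: lt; rewrite dE mE natrD -natr1; lra.
rewrite mE ler_pdivrMr ?ltr0n // natrD.
by move: le; rewrite -(ler_nat R) dE; lra.
Qed.

End NthRoot.

Theorem corollary2 (R : realType) (F : closedFieldType) (s : nat)
    (hs : (1 <= s)%N) :
  (forall n m : nat, (2 <= n)%N -> (1 <= m)%N ->
    let r : R := nth_root R n s in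
    let fl : R := (Num.floor r)%:~R in
    let eps : R := r - fl in
    2 * eps / (n%:R - 1) * (m%:R - 1) <= fl - 2 ->
    very_general (fun p : 'M[F]_(s, n.+1) =>
      ((alpha (symbolic_power p m))%:R + n%:R - 1) / (m%:R + n%:R - 1)
        <= waldschmidt R p))
  /\
  (forall n : nat, (1 <= n)%N -> nth_root R n s \is a Num.int ->
    very_general (fun p : 'M[F]_(s, n.+1) =>
      forall m : nat, (1 <= m)%N ->
        ((alpha (symbolic_power p m))%:R + n%:R - 1) / (m%:R + n%:R - 1)
          <= waldschmidt R p)).
Proof.
have vg n : (0 < n)%N -> very_general (fun p : 'M[F]_(s, n.+1) =>
    (`|Num.floor (nth_root R n s)|%N)%:R <= waldschmidt R p).
  move=> n0; apply: very_general_waldschmidt_ge => //.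
    exact: floor_nth_root_gt0.
  exact: floor_nth_rootX.
split=> [n m n2 m1 r fl eps hm|n n1 rint].
  have n0 : (0 < n)%N by exact: ltnW.
  apply: very_general_mono (vg n n0) => p hp; apply: demailly_bound => //.
  rewrite -floor_nth_root -/r -/fl.
  have eps1 : eps < 1 by have /andP[_] := floor_itv r; rewrite intrD ltrBlDl.
  have n1 : 0 < n%:R - 1 :> R by rewrite subr_gt0 ltr1n.
  have {}hm : 2 * eps * (m%:R - 1) <= (fl - 2) * (n%:R - 1).
    by rewrite -ler_pdivrMr // mulrAC.
  (* Strictness comes from here: adding this to [hm] gives exactly the inequality required after
     substituting r = fl + eps. *)
  have : eps * (n%:R + 1) < n%:R + 1 by rewrite gtr_pMl //; lra.
  have -> : r = fl + eps by rewrite addrC subrK.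
  lra.
apply: very_general_mono (vg n n1) => p hp kw m m1; apply: demailly_bound => //.
rewrite -floor_nth_root floorK //.
set r := nth_root R n s; have r1 : 1 <= r by apply: nth_root_ge1.
have : 0 <= (r - 1) * (n%:R - 1) by rewrite mulr_ge0 ?subr_ge0 ?ler1n.
lra.
Qed.
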